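(* Fix $\theta\in(0,1)$ and $\zeta\in(0,\frac12)$. There is a constant $C>0$ depending only on $\theta$ and $\zeta$ such that the following holds. Let $A\in\mathbb{R}^{m\times n}$ have full row rank $m\le n$, let $(x,y,s)\in\mathcal{N}_2(\theta)$, $\sigma\in[0,1]$, $p=-\sigma\mu AS^{-1}\mathbf{1}_n+Ax$, $\eta\in(0,1)$, and $\delta>0$ with $n\mu/\delta\ge2$. Let $\widetilde{\Delta y}$ be computed by the sketch-preconditioned conjugate gradient algorithm (described in the context) run for $t$ iterations with sketching matrix $W$, and let $$v=(XS)^{1/2}\,W\,(ADW)^\dagger\,(AD^2A^T\widetilde{\Delta y}-p).$$ Then, with probability at least $1-\eta$ over $W$, $\|v\|_2\le\delta$ for every $t\ge C\log\frac{n\mu}{\delta}$. (That is, $t=\mathcal{O}\big(\log\frac{n\mu}{\delta}\big)$ iterations suffice.)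
   Context: $\mathbf{1}_n$ is the all-ones vector, $\circ$ the entrywise product, and $^\dagger$ the Moore–Penrose pseudoinverse. For $(x,y,s)$ with $x,s\in\mathbb{R}^n$ entrywise positive and $y\in\mathbb{R}^m$: $X=\mathrm{diag}(x)$, $S=\mathrm{diag}(s)$, $D=X^{1/2}S^{-1/2}$ (so $D^2=XS^{-1}$), and $\mu=\frac1n x^Ts$. $\mathcal{N}_2(\theta)=\{(x,y,s):\ \|x\circ s-\mu\mathbf{1}_n\|_2\le\theta\mu,\ (x,s)>0\}$. Sketching matrix. Let $AD=U\Sigma V^T$ be a thin SVD ($V\in\mathbb{R}^{n\times m}$ with orthonormal columns). $W\in\mathbb{R}^{n\times w}$ is the sparse random sign matrix, drawn independently of everything else, in which each row has exactly $r$ nonzero entries, at positions chosen uniformly without replacement (independently over rows), each nonzero entry being $\pm\frac{1}{\sqrt r}$ with independent uniform signs; here $w=\mathcal{O}(\frac{m}{\zeta^2}\log\frac m\eta)$ and $r=\mathcal{O}(\frac1\zeta\log\frac m\eta)$ are chosen (with sufficiently large absolute constants) so that $\|V^TWW^TV-I_m\|_2\le\zeta/2$ with probability at least $1-\eta$ (a known guarantee for this construction). Algorithm. Let $Q=ADWW^TDA^T$ and compute $Q^{-1/2}$ (from the SVD of $ADW$). Starting from $\tilde z^0=0$, run $t$ iterations of the standard conjugate gradient method on the system $Q^{-1/2}AD^2A^TQ^{-1/2}\tilde z=Q^{-1/2}p$, obtaining $\tilde z^t$, and return $\widetilde{\Delta y}=Q^{-1/2}\tilde z^t$. *)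

(* Defs.v *)
From HB Require Import structures.
From mathcomp Require Import all_boot all_order all_algebra.
From mathcomp Require Import all_classical all_reals all_analysis.

Set Implicit Arguments.
Unset Strict Implicit.
Unset Printing Implicit Defensive.

Import Order.TTheory GRing.Theory Num.Theory.

Local Open Scope classical_set_scope.
Local Open Scope ring_scope.

Section LinearAlgebra.
Variable R : realType.

Definition dotv k (u v : 'cV[R]_k) : R := (u^T *m v) 0 0.

(* The library's norm `|u| on matrices is the max norm, hence this definition. *)
Definition norm2 k (u : 'cV[R]_k) : R := Num.sqrt (dotv u u).

Definition opnorm2 k l (M : 'M[R]_(k, l)) : R :=
  sup [set norm2 (M *m u) | u in [set u : 'cV[R]_l | norm2 u <= 1]].

Definition dg k (u : 'cV[R]_k) : 'M[R]_k := diag_mx u^T.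

Definition ones k : 'cV[R]_k := const_mx 1.

(* The four Penrose equations. The library's pinvmx is only a one-sided partial
   inverse, not the Moore-Penrose pseudoinverse. *)
Definition is_pinv k l (M : 'M[R]_(k, l)) (P : 'M[R]_(l, k)) : Prop :=
  [/\ M *m P *m M = M, P *m M *m P = P,
      (M *m P)^T = M *m P & (P *m M)^T = P *m M].

(* is_pinv M has exactly one solution, so the default value is never used. *)
Definition pinvMP k l (M : 'M[R]_(k, l)) : 'M[R]_(l, k) :=
  xget 0 [set P | is_pinv M P].

Definition is_psd k (M : 'M[R]_k) : Prop :=
  M^T = M /\ forall u : 'cV[R]_k, 0 <= dotv u (M *m u).

(* The principal square root; 0 if M is not positive semidefinite. *)
Definition sqrtmx k (M : 'M[R]_k) : 'M[R]_k :=
  xget 0 [set P | is_psd P /\ P *m P = M].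

(* M^{-1/2}; meaningful for M positive definite. *)
Definition invsqrtmx k (M : 'M[R]_k) : 'M[R]_k := sqrtmx (invmx M).

(* M = U diag(sg) V^T with k singular values; U is k x k. *)
Definition thin_svd k l (M : 'M[R]_(k, l)) (U : 'M[R]_k) (sg : 'cV[R]_k)
    (V : 'M[R]_(l, k)) : Prop :=
  [/\ U^T *m U = 1%:M, V^T *m V = 1%:M, forall i, 0 <= sg i 0
    & M = U *m dg sg *m V^T].

End LinearAlgebra.

Section ConjugateGradient.
Variables (R : realType) (k : nat) (B : 'M[R]_k) (b : 'cV[R]_k).

(* A state is (iterate, residual, search direction). Since a / 0 = 0, once the
   residual vanishes the search direction vanishes too and the iterate stays
   constant: this is the usual stopping rule. *)
Definition cg_state : Type := ('cV[R]_k * 'cV[R]_k * 'cV[R]_k)%type.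

Definition cg_step (st : cg_state) : cg_state :=
  let: (z, res, d) := st in
  let alpha := dotv res res / dotv d (B *m d) in
  let res' := res - alpha *: (B *m d) in
  let beta := dotv res' res' / dotv res res in
  (z + alpha *: d, res', res' + beta *: d).

Definition cg_iterate (t : nat) : 'cV[R]_k := (iter t cg_step (0, b, b)).1.1.

End ConjugateGradient.

Section Sketch.
Variable R : realType.

(* A sample point records, independently for each row, the set of the r nonzero
   positions, and for each entry a sign (true for -1); signs outside the chosen
   positions are ignored. Under the uniform distribution on this product, the
   positions are uniform without replacement, the signs are uniform, and all of
   these are independent. *)
Definition sketch_sample (n w r : nat) : finType :=
  ({ffun 'I_n -> {P : {set 'I_w} | #|P| == r}} * 'M[bool]_(n, w))%type.

Definition sketch_mx n w r (om : sketch_sample n w r) : 'M[R]_(n, w) :=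
  \matrix_(i, j) (if j \in val (om.1 i)
                  then (-1) ^+ om.2 i j / Num.sqrt r%:R else 0).

Definition unif_pr (T : finType) (E : T -> Prop) : R :=
  #|[pred om : T | `[< E om >]]|%:R / #|T|%:R.

End Sketch.

Section InteriorPoint.
Variables (R : realType) (m n : nat).
Implicit Types (A : 'M[R]_(m, n)) (x s : 'cV[R]_n) (y : 'cV[R]_m).

Definition mu x s : R := n%:R^-1 * dotv x s.

Definition N2 (theta : R) x y s : Prop :=
  norm2 (map2_mx *%R x s - mu x s *: ones R n) <= theta * mu x s
  /\ forall i, 0 < x i 0 /\ 0 < s i 0.

Definition Dmx x s : 'M[R]_n :=
  dg (\col_i (Num.sqrt (x i 0) / Num.sqrt (s i 0))).

Definition XShalf x s : 'M[R]_n := dg (\col_i Num.sqrt (x i 0 * s i 0)).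

Definition rhs (sigma : R) A x s : 'cV[R]_m :=
  - ((sigma * mu x s) *: (A *m invmx (dg s) *m ones R n)) + A *m x.

Definition normal_mx A x s : 'M[R]_m := A *m (Dmx x s *m Dmx x s) *m A^T.

Definition Qmx A x s w (W : 'M[R]_(n, w)) : 'M[R]_m :=
  A *m Dmx x s *m W *m W^T *m Dmx x s *m A^T.

Definition sketch_pcg A x s w (W : 'M[R]_(n, w)) (p : 'cV[R]_m) (t : nat) :
    'cV[R]_m :=
  let Qi := invsqrtmx (Qmx A x s W) in
  Qi *m cg_iterate (Qi *m normal_mx A x s *m Qi) (Qi *m p) t.

Definition correction A x s w (W : 'M[R]_(n, w)) (p dy : 'cV[R]_m) : 'cV[R]_n :=
  XShalf x s *m W *m pinvMP (A *m Dmx x s *m W) *m (normal_mx A x s *m dy - p).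

End InteriorPoint.

(* Main.v *)
Require Import Defs.
From mathcomp Require Import all_boot all_order all_algebra.
From mathcomp Require Import all_classical all_reals all_analysis.
From mathcomp Require Import ring lra complex.
Import Order.TTheory GRing.Theory Num.Theory.
Local Open Scope ring_scope.

(* Put M = AD, K = MW and Q = K K^T. On the event that W embeds the row space of
   M, the quadratic form of Q is within factors 3/4 and 5/4 of that of M M^T, so
   the preconditioned matrix B = Q^{-1/2} M M^T Q^{-1/2} has spectrum in
   [4/5, 4/3] and conjugate gradients contract the energy by 2/5 per step.
   If b - B z is the residual, v = - (XS)^{1/2} W K^T Q^{-1/2} (b - B z), where
   K^T Q^{-1/2} is an isometry and, the rows of W being unit vectors,
   (XS)^{1/2} W has squared Frobenius norm x^T s = n mu. Finally
   p = M ((XS)^{1/2} 1 - sigma mu (XS)^{-1/2} 1) gives b^T b = O(n mu) by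
   centrality, so |v| <= c (2/5)^{t/2} n mu. *)

(** * Euclidean inner product, norm and operator norm *)

Section DotProduct.
Context {R : realType}.

Lemma dotvE {k} (u v : 'cV[R]_k) : dotv u v = \sum_i u i 0 * v i 0.
Proof. by rewrite /dotv mxE; apply: eq_bigr => i _; rewrite mxE. Qed.

Lemma dotvC {k} (u v : 'cV[R]_k) : dotv u v = dotv v u.
Proof. by rewrite !dotvE; apply: eq_bigr => i _; rewrite mulrC. Qed.

Lemma dotvDr {k} (u v w : 'cV[R]_k) : dotv u (v + w) = dotv u v + dotv u w.
Proof. by rewrite /dotv mulmxDr mxE. Qed.

Lemma dotvDl {k} (u v w : 'cV[R]_k) : dotv (u + v) w = dotv u w + dotv v w.
Proof. by rewrite dotvC dotvDr !(dotvC w). Qed.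

Lemma dotvZr {k} a (u v : 'cV[R]_k) : dotv u (a *: v) = a * dotv u v.
Proof. by rewrite /dotv -scalemxAr mxE. Qed.

Lemma dotvZl {k} a (u v : 'cV[R]_k) : dotv (a *: u) v = a * dotv u v.
Proof. by rewrite dotvC dotvZr dotvC. Qed.

Lemma dotvNr {k} (u v : 'cV[R]_k) : dotv u (- v) = - dotv u v.
Proof. by rewrite -scaleN1r dotvZr mulN1r. Qed.

Lemma dotvNl {k} (u v : 'cV[R]_k) : dotv (- u) v = - dotv u v.
Proof. by rewrite dotvC dotvNr dotvC. Qed.

Lemma dotv0r {k} (u : 'cV[R]_k) : dotv u 0 = 0.
Proof. by rewrite /dotv mulmx0 mxE. Qed.

Lemma dotv0l {k} (u : 'cV[R]_k) : dotv 0 u = 0.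
Proof. by rewrite dotvC dotv0r. Qed.

Definition dotv_lin :=
  (@dotvDl, @dotvDr, @dotvZl, @dotvZr, @dotvNl, @dotvNr).

Lemma dotv_trmx {k l} (M : 'M[R]_(k, l)) u v :
  dotv (M *m u) v = dotv u (M^T *m v).
Proof. by rewrite /dotv trmx_mul mulmxA. Qed.

Lemma dotv_ge0 {k} (u : 'cV[R]_k) : 0 <= dotv u u.
Proof. by rewrite dotvE; apply: sumr_ge0 => i _; rewrite -expr2 sqr_ge0. Qed.

Lemma dotv_eq0 {k} (u : 'cV[R]_k) : dotv u u = 0 -> u = 0.
Proof.
rewrite dotvE => /psumr_eq0P u0; apply/matrixP => i j; rewrite (ord1 j) mxE.
have /u0 /(_ i isT)/eqP : forall i, true -> 0 <= u i 0 * u i 0.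
  by move=> i' _; rewrite -expr2 sqr_ge0.
by rewrite -expr2 sqrf_eq0 => /eqP.
Qed.

Lemma dotv_Cauchy_Schwarz {k} (u v : 'cV[R]_k) :
  dotv u v ^+ 2 <= dotv u u * dotv v v.
Proof.
have := dotv_ge0 v; rewrite le_eqVlt => /orP[/eqP/esym/dotv_eq0 ->|v_gt0].
  by rewrite !dotv0r expr0n mulr0.
(* Expanding this square gives the claim multiplied by [v.v > 0]. *)
have := dotv_ge0 (dotv v v *: u - dotv u v *: v); rewrite !dotv_lin (dotvC v u).
move: (dotv u u) (dotv u v) (dotv v v) v_gt0 => a b c c_gt0 h.
by rewrite -(ler_pM2l c_gt0); lra.
Qed.

Lemma norm2_ge0 {k} (u : 'cV[R]_k) : 0 <= norm2 u.
Proof. exact: sqrtr_ge0. Qed.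

Lemma norm2_sqr {k} (u : 'cV[R]_k) : norm2 u ^+ 2 = dotv u u.
Proof. by rewrite sqr_sqrtr // dotv_ge0. Qed.

Lemma norm2_le {k} (u : 'cV[R]_k) a :
  0 <= a -> dotv u u <= a ^+ 2 -> norm2 u <= a.
Proof.
move=> a_ge0 h.
by rewrite -(ler_pXn2r (n := 2)) ?nnegrE ?norm2_ge0 // norm2_sqr.
Qed.

Lemma norm2Z {k} a (u : 'cV[R]_k) : norm2 (a *: u) = `|a| * norm2 u.
Proof.
by rewrite /norm2 !dotv_lin mulrA -expr2 sqrtrM ?sqr_ge0 // sqrtr_sqr.
Qed.

(** Cauchy-Schwarz on each row; with [c] the squared row norms this is the Frobenius bound. *)
Lemma dotv_mulmx_le {k l} (M : 'M[R]_(k, l)) (c : 'I_k -> R) (u : 'cV[R]_l) :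
  (forall i, dotv (row i M)^T (row i M)^T <= c i) ->
  dotv (M *m u) (M *m u) <= (\sum_i c i) * dotv u u.
Proof.
move=> hc; rewrite dotvE mulr_suml; apply: ler_sum => i _.
have -> : (M *m u) i 0 = dotv (row i M)^T u.
  by rewrite dotvE mxE; apply: eq_bigr => j _; rewrite !mxE.
by rewrite -expr2 (le_trans (dotv_Cauchy_Schwarz _ _)) // ler_wpM2r ?dotv_ge0.
Qed.

Lemma opnorm2_mulmx {k l} (M : 'M[R]_(k, l)) u :
  norm2 (M *m u) <= opnorm2 M * norm2 u.
Proof.
have := norm2_ge0 u; rewrite le_eqVlt => /orP[/eqP u0|u_gt0].
  have /dotv_eq0 -> : dotv u u = 0 by rewrite -norm2_sqr -u0 expr0n.
  by rewrite mulmx0 /norm2 !dotv0r sqrtr0 mulr0.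
have -> : M *m u = norm2 u *: (M *m ((norm2 u)^-1 *: u)).
  by rewrite -scalemxAr scalerA mulfV ?gt_eqF // scale1r.
rewrite norm2Z (ger0_norm (ltW u_gt0)) mulrC ler_pM2r //.
apply: ub_le_sup; last first.
  exists ((norm2 u)^-1 *: u) => //=.
  have ui_ge0 : 0 <= (norm2 u)^-1 by rewrite invr_ge0 ltW.
  by rewrite norm2Z (ger0_norm ui_ge0) mulVf ?gt_eqF.
(* [sup] is an upper bound only when the set is bounded; the Frobenius norm bounds it. *)
pose c := \sum_i dotv (row i M)^T (row i M)^T.
have c_ge0 : 0 <= c by apply: sumr_ge0 => i _; rewrite dotv_ge0.
exists (Num.sqrt c) => _ [v /= v1 <-].
apply: norm2_le; rewrite ?sqrtr_ge0 // sqr_sqrtr //.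
apply: le_trans
  (dotv_mulmx_le _ (fun i => dotv (row i M)^T (row i M)^T) _ _) _ => //.
by rewrite -norm2_sqr ler_piMr // exprn_ile1 ?norm2_ge0.
Qed.

Lemma dotv_opnorm2 {k} (M : 'M[R]_k) u :
  `|dotv u (M *m u)| <= opnorm2 M * dotv u u.
Proof.
have le_norm : `|dotv u (M *m u)| <= norm2 u * norm2 (M *m u).
  rewrite -(ler_pXn2r (n := 2)) ?nnegrE ?mulr_ge0 ?norm2_ge0 //.
  by rewrite real_normK ?num_real // exprMn !norm2_sqr dotv_Cauchy_Schwarz.
apply: le_trans le_norm _; rewrite -norm2_sqr expr2 mulrCA.
by rewrite ler_wpM2l ?norm2_ge0 // opnorm2_mulmx.
Qed.

Lemma posdef_unitmx {k} (M : 'M[R]_k) :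
  (forall u, dotv u (M *m u) = 0 -> u = 0) -> M \in unitmx.
Proof.
move=> hM; rewrite -unitmx_tr -row_free_unit -kermx_eq0.
apply/eqP/row_matrixP => i; rewrite row0.
apply: trmx_inj; rewrite trmx0; apply: hM.
have : row i (kermx M^T) *m M^T = 0 by rewrite -row_mul mulmx_ker row0.
by move=> /(congr1 trmx); rewrite trmx_mul trmxK trmx0 => ->; rewrite dotv0r.
Qed.

End DotProduct.

(** * Convergence rate of conjugate gradients *)

Section ConjugateGradientRate.
Context {R : realType} {k : nat} (B : 'M[R]_k) (b : 'cV[R]_k) (l L : R).
Hypothesis B_sym : B^T = B.
Hypothesis l_gt0 : 0 < l.
Hypothesis le_lL : l <= L.
Hypothesis B_lb : forall u, l * dotv u u <= dotv u (B *m u).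
Hypothesis B_ub : forall u, dotv u (B *m u) <= L * dotv u u.

Let dotvB u v : dotv (B *m u) v = dotv u (B *m v).
Proof. by rewrite dotv_trmx B_sym. Qed.

Let dotv_B_eq0 u : dotv u (B *m u) = 0 -> u = 0.
Proof.
move=> u0; apply: dotv_eq0; apply: le_anti; rewrite dotv_ge0 andbT.
by rewrite -(pmulr_rle0 _ l_gt0) (le_trans (B_lb u)) // u0.
Qed.

(* The last equation is B-conjugacy of d to the previous direction. *)
Definition cg_inv (st : cg_state R k) :=
  let: (z, res, d) := st in
  [/\ res = b - B *m z, dotv d res = dotv res res
    & dotv d (B *m res) = dotv d (B *m d)].

Lemma cg_inv_step st : cg_inv st -> cg_inv (cg_step B st).
Proof.
case: st => [[z res] d] [res_def d_res d_conj] /=.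
set alpha := _ / _; set res' := res - _; set beta := _ / _.
have alphaE : alpha * dotv d (B *m d) = dotv res res.
  (* A zero denominator forces [d = 0], hence [res.res = d.res = 0], and the equation survives the
     default value of the quotient. *)
  rewrite /alpha; have [/dotv_B_eq0 d0|dBd] := eqVneq (dotv d (B *m d)) 0.
    by rewrite -d_res d0 !dotv0l !mul0r.
  by rewrite mulfVK.
have res'E : res' = res - alpha *: (B *m d) by [].
clearbody alpha res'.
have d_res' : dotv d res' = 0 by rewrite res'E !dotv_lin alphaE d_res subrr.
have res_res' : dotv res' res = 0.
  by rewrite res'E !dotv_lin dotvB d_conj alphaE subrr.
split.
- by rewrite res'E res_def mulmxDr -scalemxAr opprD addrA.
- by rewrite dotvDl dotvZl d_res' mulr0 addr0.
rewrite mulmxDr -scalemxAr dotvDr -[LHS]addr0; congr (_ + _).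
rewrite dotvZr dotvDl dotvZl.
(* It remains that [beta] times [d'.Bd] vanishes, [d'] being the new direction. If [res.res = 0]
   then [beta = 0] by default. Otherwise scale by [res.res = alpha d.Bd] and replace [alpha Bd] by
   [res - res']; then [res'.res = 0] makes the terms cancel. *)
have [rr0|rr_neq0] := eqVneq (dotv res res) 0.
  by rewrite /beta rr0 invr0 mulr0 mul0r.
suff : dotv res res * (dotv res' (B *m d) + beta * dotv d (B *m d)) = 0.
  by move/eqP; rewrite mulf_eq0 (negPf rr_neq0) => /eqP ->; rewrite mulr0.
rewrite mulrDr mulrA [_ * beta]mulrC /beta mulfVK //.
rewrite -{1}alphaE mulrAC -(dotvZr alpha).
have -> : alpha *: (B *m d) = res - res' by rewrite res'E opprB addrC subrK.
by rewrite dotvDr dotvNr res_res' sub0r mulNr addNr.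
Qed.

Lemma cg_invP t : cg_inv (iter t (cg_step B) (0, b, b)).
Proof.
elim: t => [|t IHt]; last by rewrite iterS; apply: cg_inv_step.
by split; rewrite // mulmx0 subr0.
Qed.

Let zs := invmx B *m b.
Let energy z := dotv (zs - z) (B *m (zs - z)).

Let B_unit : B \in unitmx.
Proof. exact: posdef_unitmx dotv_B_eq0. Qed.

Let B_err z : B *m (zs - z) = b - B *m z.
Proof. by rewrite mulmxBr mulKVmx. Qed.

Let L_gt0 : 0 < L := lt_le_trans l_gt0 le_lL.

(** This is [l B <= B^2]: expand [|Be - l e|^2 >= 0] and use [l e.e <= e.Be]. *)
Let energy_le z : l * energy z <= dotv (b - B *m z) (b - B *m z).
Proof.
rewrite /energy -B_err; move: (zs - z) => e.
have := dotv_ge0 (B *m e - l *: e); rewrite !dotv_lin (dotvC _ e).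
have := B_lb e; move: (dotv e e) (dotv e (B *m e)) (dotv (B *m e) _) => p q s.
by have := l_gt0; nra.
Qed.

(** This is [B^2 <= L B]: expand the form of [B] at [L e - Be], and bound its cubic term by applying
    [B_ub] to [Be]. *)
Let le_energy z : dotv (b - B *m z) (b - B *m z) <= L * energy z.
Proof.
rewrite /energy -B_err; move: (zs - z) => e.
have /le_trans : 0 <= l * dotv (L *: e - B *m e) (L *: e - B *m e).
  by rewrite mulr_ge0 ?dotv_ge0 ?ltW.
move=> /(_ _ (B_lb _)); have := B_ub (B *m e).
rewrite !mulmxDr !mulmxN -!scalemxAr !dotv_lin !dotvB.
move: (dotv e (B *m e)) (dotv e (B *m (B *m e))) (dotv e _) => q s v h1 h2.
by rewrite -(ler_pM2l L_gt0); lra.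
Qed.

(* A step of conjugate gradients decreases the energy at least as much as the
   steepest descent step, since conjugacy gives d.Bd <= res.B res. *)
Lemma energy_step st : cg_inv st ->
  energy (cg_step B st).1.1 <= (1 - l / L) * energy st.1.1.
Proof.
case: st => [[z res] d] [res_def d_res d_conj] /=.
set alpha := _ / _.
have -> : energy (z + alpha *: d) = energy z - 2 * alpha * dotv d res +
    alpha ^+ 2 * dotv d (B *m d).
  have Be : B *m (zs - z) = res by rewrite B_err -res_def.
  rewrite /energy opprD addrA; move: (zs - z) Be => e Be.
  rewrite mulmxDr mulmxN -scalemxAr !dotv_lin -(dotvB e d) Be.
  rewrite (dotvC res d) (dotvC e res).
  by ring.
have dBd_le : dotv d (B *m d) <= dotv res (B *m res).
  have /le_trans : 0 <= l * dotv (d - res) (d - res).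
    by rewrite mulr_ge0 ?dotv_ge0 ?ltW.
  move=> /(_ _ (B_lb _)); rewrite mulmxDr mulmxN !dotv_lin.
  by rewrite -(dotvB res d) (dotvC _ d) d_conj; lra.
have := energy_le z; rewrite -res_def.
(* A zero direction means a zero residual, so the energy is at most 0 and the factor [1 - l / L]
   cannot decrease it. *)
have [/dotv_B_eq0 d0|dBd_neq0] := eqVneq (dotv d (B *m d)) 0.
  rewrite -d_res d0 !dotv0l !mulr0 subr0 addr0.
  by rewrite (pmulr_rle0 _ l_gt0) => E_le0; rewrite mulrBl mul1r lerDl oppr_ge0
    pmulr_rle0 // divr_gt0.
have dBd_gt0 : 0 < dotv d (B *m d).
  rewrite lt_neqAle eq_sym dBd_neq0 (le_trans _ (B_lb d)) //.
  by rewrite mulr_ge0 ?dotv_ge0 ?ltW.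
have := B_ub res; have := dotv_ge0 res; rewrite /alpha d_res.
move: (dotv res res) (dotv d _) (dotv res _) (energy z) dBd_le dBd_gt0.
move=> rr dBd rBr E h1 dBd_gt0 rr_ge0 h2 h3.
have -> : E - 2 * (rr / dBd) * rr + (rr / dBd) ^+ 2 * dBd = E - rr * (rr / dBd).
  by field; rewrite gt_eqF.
rewrite mulrBl mul1r lerD2l lerN2.
(* The decrease [rr^2 / dBd] is at least [rr / L] because [dBd <= L rr], and [rr >= l E]. *)
apply: (@le_trans _ _ (rr / L)).
  by rewrite mulrAC ler_pM2r ?invr_gt0.
rewrite ler_wpM2l // ler_pdivlMr // mulrC ler_pdivrMr //; lra.
Qed.

(** Bounding the last residual by its energy costs [L], and the initial energy by [b.b] costs
    [1 / l]; hence the condition number in front. *)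
Lemma cg_residual_le t :
  dotv (b - B *m cg_iterate B b t) (b - B *m cg_iterate B b t) <=
  L / l * (1 - l / L) ^+ t * dotv b b.
Proof.
apply: le_trans (le_energy _) _.
rewrite -!mulrA ler_pM2l // mulrCA.
have rho_ge0 : 0 <= 1 - l / L by rewrite subr_ge0 ler_pdivrMr // mul1r.
apply: (@le_trans _ _ ((1 - l / L) ^+ t * energy 0)).
  rewrite /cg_iterate; elim: t => [|t IHt]; first by rewrite expr0 mul1r.
  rewrite iterS (le_trans (energy_step _ (cg_invP _))) // exprS -mulrA.
  by rewrite ler_wpM2l.
rewrite ler_wpM2l ?exprn_ge0 // ler_pdivlMl //.
by have := energy_le 0; rewrite mulmx0 subr0.
Qed.

End ConjugateGradientRate.

(** * Interpolation, matrix square roots and pseudoinverses *)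

Lemma poly_interpolation (F : fieldType) (s : seq F) (f : F -> F) :
  exists p : {poly F}, {in s, forall z, p.[z] = f z}.
Proof.
elim: s => [|a s [p p_s]]; first by exists 0.
have [a_s|a_s] := boolP (a \in s).
  by exists p => z; rewrite inE => /predU1P[->|]; apply: p_s.
(* [q] vanishes on [s] but not at [a], so a multiple of it corrects the value at [a] alone. *)
pose q := \prod_(z <- s) ('X - z%:P).
exists (p + ((f a - p.[a]) / q.[a]) *: q) => z.
have qa_neq0 : q.[a] != 0 by rewrite -rootE root_prod_XsubC.
rewrite inE hornerD hornerZ => /predU1P[->|z_s].
  by rewrite mulfVK // addrC subrK.
have /rootP -> : root q z by rewrite root_prod_XsubC.
by rewrite mulr0 addr0 p_s.
Qed.

Section SquareRoot.
Context {R : realType}.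

Lemma trmx_horner_mx {k} (A : 'M[R]_k.+1) p :
  A^T = A -> (horner_mx A p)^T = horner_mx A p.
Proof.
move=> A_sym; elim/poly_ind: p => [|p c IHp]; first by rewrite rmorph0 trmx0.
rewrite rmorphD rmorphM /= horner_mx_X horner_mx_C linearD /= tr_scalar_mx.
rewrite trmx_mul A_sym IHp; congr (_ + _).
exact: comm_mx_horner.
Qed.

(* The spectral theorem over R[i], stated so that only real data remain: p(A)
   depends only on the values of p at the (real) eigenvalues of A. *)
Lemma symmetric_horner_mx {k} (A : 'M[R]_k.+1) : A^T = A ->
  exists d : 'I_k.+1 -> R, (forall i, eigenvalue A (d i)) /\
    forall p q, (forall i, p.[d i] = q.[d i]) -> horner_mx A p = horner_mx A q.
Proof.
move=> A_sym; pose AC := map_mx (real_complex R) A.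
have AC_herm : AC \is hermsymmx.
  apply: realsym_hermsym.
    by apply/is_hermitianmxP; rewrite expr0 scale1r map_mx_id // map_trmx A_sym.
  by apply/mxOverP => i j; rewrite mxE complex_real.
have /orthomx_spectralP := hermitian_normalmx AC_herm.
have := hermitian_spectral_diag_real AC_herm.
have := spectral_unit AC.
move: (spectralmx AC) (spectral_diag AC) => P D P_unit /mxOverP D_real ACE.
(* The eigenvalues [D] are real, so [d] loses nothing; the rows of [P] are left eigenvectors. *)
pose d i := complex.Re (D 0 i).
have dE i : (d i)%:C%C = D 0 i by rewrite /d RRe_real.
exists d; split=> [i|p q pq].
  rewrite eigenvalue_root_char -(fmorph_root (real_complex R)) map_char_poly.
  rewrite -eigenvalue_root_char; apply/eigenvalueP; exists (row i P).
    rewrite -/AC ACE !mulmxA -row_mul mulmxV // -row_mul mul1mx.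
    rewrite row_diag_mx -scalemxAl -rowE; congr (_ *: _).
    exact/esym/dE.
  apply/eqP => Pi0; have := congr1 (mulmx^~ (invmx P)) Pi0.
  rewrite -row_mul mulmxV // mul0mx => /rowP/(_ i)/eqP.
  by rewrite !mxE eqxx oner_eq0.
have horner_AC r : horner_mx (map_mx (real_complex R) A) r =
    invmx P *m diag_mx (map_mx (horner r) D) *m P.
  by rewrite -/AC ACE -horner_mx_diag; apply: horner_mx_uconjC.
apply: (map_mx_inj (f := real_complex R)); rewrite !map_horner_mx !horner_AC.
suff -> : map_mx (horner (map_poly (real_complex R) p)) D =
    map_mx (horner (map_poly (real_complex R) q)) D by [].
by apply/rowP => i; rewrite !mxE -dE !horner_map pq.
Qed.

(* The root is p(A) with p interpolating the square root at the eigenvalues; it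
   is positive semidefinite because p(A) = q(A)^2 with q interpolating fourth
   roots. *)
Lemma psd_sqrt_exists {k} (A : 'M[R]_k) :
  is_psd A -> exists P : 'M[R]_k, is_psd P /\ P *m P = A.
Proof.
case: k A => [|k] A [A_sym A_psd].
  by exists A; split; [split | rewrite [RHS]flatmx0 flatmx0].
have [d [d_eig horner_inj]] := symmetric_horner_mx A A_sym.
have d_ge0 i : 0 <= d i.
  have /eigenvalueP[v vA v_neq0] := d_eig i.
  have := A_psd v^T; rewrite -{1}A_sym -trmx_mul vA linearZ /= dotvZr.
  rewrite pmulr_lge0 // lt_neqAle dotv_ge0 andbT eq_sym.
  by apply: contra v_neq0 => /eqP/dotv_eq0 v0; rewrite -(trmxK v) v0 trmx0.
have [p p_sqrt] := poly_interpolation R (codom d) Num.sqrt.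
have [q q_sqrt] :=
  poly_interpolation R (codom d) (fun z => Num.sqrt (Num.sqrt z)).
exists (horner_mx A p); split; last first.
  rewrite -[_ *m _]rmorphM -[RHS]horner_mx_X; apply: horner_inj => i.
  by rewrite hornerM hornerX p_sqrt ?codom_f // -expr2 sqr_sqrtr.
split; first exact: trmx_horner_mx.
have -> : horner_mx A p = horner_mx A q *m horner_mx A q.
  rewrite -[_ *m _]rmorphM; apply: horner_inj => i.
  by rewrite hornerM p_sqrt ?q_sqrt ?codom_f // -expr2 sqr_sqrtr ?sqrtr_ge0.
by move=> u; rewrite -mulmxA -{1}(trmx_horner_mx A q A_sym) -dotv_trmx dotv_ge0.
Qed.

Lemma sqrtmxP {k} (A : 'M[R]_k) :
  is_psd A -> is_psd (sqrtmx A) /\ sqrtmx A *m sqrtmx A = A.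
Proof.
by move=> /psd_sqrt_exists A_sqrt; exact: (xgetPex 0 A_sqrt).
Qed.

(** For uniqueness, symmetry of [PK] and [KPK = K] give [P K K^T = (KPK)^T = K^T], and [K K^T]
    cancels. *)
Lemma is_pinv_row_full {k l} (K : 'M[R]_(k, l)) (P : 'M[R]_(l, k)) :
  K *m K^T \in unitmx -> is_pinv K P <-> P = K^T *m invmx (K *m K^T).
Proof.
move=> KK_unit; split=> [[KPK PKP _ PK_sym]|->].
  have KP1 : K *m P = 1%:M.
    by apply: (can_inj (mulmxK KK_unit)); rewrite !mulmxA KPK mul1mx.
  apply: (can_inj (mulmxK KK_unit)); rewrite mulmxKV // mulmxA -PK_sym.
  by rewrite -trmx_mul mulmxA KPK.
have KP1 : K *m (K^T *m invmx (K *m K^T)) = 1%:M by rewrite mulmxA mulmxV.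
split.
- by rewrite KP1 mul1mx.
- by rewrite -mulmxA KP1 mulmx1.
- by rewrite KP1 trmx1.
- by rewrite !trmx_mul trmx_inv trmx_mul !trmxK mulmxA.
Qed.

Lemma pinvMP_row_full {k l} (K : 'M[R]_(k, l)) :
  K *m K^T \in unitmx -> pinvMP K = K^T *m invmx (K *m K^T).
Proof.
move=> KK_unit; apply/(is_pinv_row_full K (pinvMP K) KK_unit).
apply: (xgetPex 0 (P := [set P | is_pinv K P]%classic)).
by exists (K^T *m invmx (K *m K^T)); apply/is_pinv_row_full.
Qed.

End SquareRoot.

(** * Monotonicity of probability and the iteration count *)

Lemma unif_pr_le (R : realType) (T : finType) (E F : T -> Prop) :
  (forall om, E om -> F om) -> unif_pr R E <= unif_pr R F.
Proof.
move=> EF; rewrite /unif_pr ler_wpM2r ?invr_ge0 ?ler0n // ler_nat.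
apply: subset_leq_card; apply/fintype.subsetP => om; rewrite !inE.
exact: EF.
Qed.

(** After taking logarithms, [- t ln rho] must dominate [ln K + 2 ln a]. Since [a >= 2], the
    constant [ln K] is absorbed as [|ln K| / ln 2 * ln a]. *)
Lemma ln_iteration_count (R : realType) (rho K : R) :
  0 < rho < 1 -> 0 < K ->
  exists2 C : R, 0 < C & forall (a : R) (t : nat),
    2 <= a -> C * ln a <= t%:R -> K * rho ^+ t * a ^+ 2 <= 1.
Proof.
move=> /andP[rho_gt0 rho_lt1] K_gt0.
have ln2_gt0 : 0 < ln (2 : R) by rewrite ln_gt0 // ltr1n.
have lnrho_gt0 : 0 < - ln rho by rewrite oppr_gt0 ln_lt0 // rho_gt0.
have C_gt0 : 0 < (2 + `|ln K| / ln 2) / - ln rho.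
  by rewrite divr_gt0 // ltr_wpDr // divr_ge0 // ltW.
exists ((2 + `|ln K| / ln 2) / - ln rho) => // a t a_ge2.
have a_gt0 : 0 < a by apply: lt_le_trans a_ge2.
have lna : ln 2 <= ln a by rewrite ler_ln ?posrE.
rewrite mulrAC ler_pdivrMr // => t_ge.
have rhot_gt0 : 0 < rho ^+ t by rewrite exprn_gt0.
have a2_gt0 : 0 < a ^+ 2 by rewrite exprn_gt0.
have Krho_gt0 : 0 < K * rho ^+ t by rewrite mulr_gt0.
rewrite -ler_ln ?posrE ?(mulr_gt0 Krho_gt0) // ln1.
rewrite (lnM Krho_gt0 a2_gt0) (lnM K_gt0 rhot_gt0).
rewrite (lnXn _ rho_gt0) (lnXn _ a_gt0).
rewrite -[ln rho *+ t]mulr_natr -[ln a *+ 2]mulr_natr.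
have lnK : ln K <= `|ln K| / ln 2 * ln a.
  apply: le_trans (ler_norm _) _.
  by rewrite -mulrA ler_peMr // mulrC ler_pdivlMr // mul1r.
by move: t_ge; rewrite mulrDl mulrN; lra.
Qed.

(** * Embedding property and row norms of the sketch *)

Section Sketching.
Context {R : realType}.

Lemma dotv_gram {k l} (M : 'M[R]_(k, l)) u v :
  dotv u (M *m M^T *m v) = dotv (M^T *m u) (M^T *m v).
Proof. by rewrite dotv_trmx trmxK mulmxA. Qed.

Lemma dotv_orthonormal {k l} (V : 'M[R]_(k, l)) u v :
  V^T *m V = 1%:M -> dotv (V *m u) (V *m v) = dotv u v.
Proof. by move=> VV; rewrite dotv_trmx mulmxA VV mul1mx. Qed.

Lemma gram_unitmx {k l} (M : 'M[R]_(k, l)) :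
  (forall u : 'cV[R]_k, M^T *m u = 0 -> u = 0) -> M *m M^T \in unitmx.
Proof.
move=> M_inj; apply: posdef_unitmx => u.
by rewrite dotv_gram => /dotv_eq0/M_inj.
Qed.

Lemma row_free_trmx_inj {k l} (M : 'M[R]_(k, l)) (u : 'cV[R]_k) :
  row_free M -> M^T *m u = 0 -> u = 0.
Proof.
move=> M_free Mu; apply: trmx_inj; apply: (row_free_inj M_free).
by rewrite -[M]trmxK -trmx_mul Mu !trmx0 mul0mx.
Qed.

(** Since [M^T u = V g] with [g = (U Sigma)^T u] and [V] is isometric, the difference is the
    quadratic form of [V^T W W^T V - 1] at [g]. *)
Lemma sketch_embedding {m n w} (M : 'M[R]_(m, n)) U sg V
    (W : 'M[R]_(n, w)) c (u : 'cV[R]_m) :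
  thin_svd M U sg V -> opnorm2 (V^T *m W *m W^T *m V - 1%:M) <= c ->
  `|dotv ((M *m W)^T *m u) ((M *m W)^T *m u) - dotv (M^T *m u) (M^T *m u)|
    <= c * dotv (M^T *m u) (M^T *m u).
Proof.
move=> [_ VV _ ->] op_le.
rewrite trmx_mul trmx_mul trmxK -!mulmxA; set g := (_ *m dg sg)^T *m u.
rewrite (dotv_orthonormal _ _ _ VV).
have -> : dotv (W^T *m (V *m g)) (W^T *m (V *m g)) =
    dotv g (V^T *m W *m W^T *m V *m g).
  by rewrite -!mulmxA -(dotv_trmx V) (dotv_trmx W^T) trmxK.
rewrite -dotvNr -dotvDr -[X in dotv g (_ - X)]mul1mx -mulmxBl.
apply: le_trans (dotv_opnorm2 _ _) _.
by rewrite ler_wpM2r ?dotv_ge0.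
Qed.

(** Row [i] of the weighted matrix has squared norm [c i], so the sum is its squared Frobenius
    norm. *)
Lemma diag_weight_mulmx_le {n w} (c : 'I_n -> R) (W : 'M[R]_(n, w))
    (z : 'cV[R]_w) :
  (forall i, 0 <= c i) -> (forall i, dotv (row i W)^T (row i W)^T = 1) ->
  norm2 (dg (\col_i Num.sqrt (c i)) *m W *m z) ^+ 2 <= (\sum_i c i) * dotv z z.
Proof.
move=> c_ge0 W1; rewrite norm2_sqr; apply: dotv_mulmx_le => i.
have -> : (row i (dg (\col_i Num.sqrt (c i)) *m W))^T =
    Num.sqrt (c i) *: (row i W)^T.
  apply/matrixP => j k; rewrite /dg !mxE (bigD1 i) //= big1 => [|l il].
    by rewrite !mxE eqxx mulr1n addr0.
  by rewrite !mxE eq_sym (negPf il) mul0r.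
by rewrite !dotv_lin W1 mulr1 -expr2 sqr_sqrtr.
Qed.

(** There are [r] entries of square [1 / r]; this holds for every sample, not only on the embedding
    event. *)
Lemma sketch_row_unit {n w r} (om : sketch_sample n w r) i : (0 < r)%N ->
  dotv (row i (sketch_mx R om))^T (row i (sketch_mx R om))^T = 1.
Proof.
move=> r_gt0; rewrite dotvE.
rewrite (bigID (fun j => j \in val (om.1 i))) /= [X in _ + X]big1 => [|j jP].
  rewrite addr0 (eq_bigr (fun=> r%:R^-1)) => [|j jP].
    rewrite sumr_const (eqP (valP (om.1 i))) -[LHS]mulr_natl mulfV //.
    by rewrite pnatr_eq0 -lt0n.
  rewrite !mxE jP mulrACA -invfM -signr_addb addbb mul1r.
  by rewrite -expr2 sqr_sqrtr ?ler0n.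
by rewrite !mxE (negPf jP) mul0r.
Qed.

End Sketching.

(** * The preconditioned system under an embedding with distortion [1/4] *)

Section PreconditionedCG.
Context {R : realType} {m n w : nat} (M : 'M[R]_(m, n)) (W : 'M[R]_(n, w)).
Let K := M *m W.
Hypothesis M_inj : forall u : 'cV[R]_m, M^T *m u = 0 -> u = 0.
Hypothesis embed_lb : forall u,
  3 / 4 * dotv (M^T *m u) (M^T *m u) <= dotv (K^T *m u) (K^T *m u).
Hypothesis embed_ub : forall u,
  dotv (K^T *m u) (K^T *m u) <= 5 / 4 * dotv (M^T *m u) (M^T *m u).

Lemma sketched_gram_unitmx : K *m K^T \in unitmx.
Proof.
apply: gram_unitmx => u Ku; apply: M_inj; apply: dotv_eq0.
by have := embed_lb u; have := dotv_ge0 (M^T *m u); rewrite Ku dotv0r; lra.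
Qed.

Let Q_unit := sketched_gram_unitmx.
Let Qi := invsqrtmx (K *m K^T).
Let B := Qi *m (M *m M^T) *m Qi.

Let Qi_props : Qi^T = Qi /\ Qi *m Qi = invmx (K *m K^T).
Proof.
suff /sqrtmxP[[]] : is_psd (invmx (K *m K^T)) by [].
split; first by rewrite trmx_inv trmx_mul trmxK.
(* With [Q = K K^T], [u.Q^{-1}u = |K^T Q^{-1}u|^2]. *)
by move=> u; rewrite -{1}(mulKVmx Q_unit u) dotvC dotv_gram dotv_ge0.
Qed.

Let QiQQi : Qi *m (K *m K^T) *m Qi = 1%:M.
Proof.
(* From [Qi (Qi Q) = 1] the factors may be swapped, as for any square one-sided inverse. *)
apply: mulmx1C; rewrite (mulmxA Qi Qi) (proj2 Qi_props).
by rewrite mulVmx.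
Qed.

Let QiK_isometry u : dotv (K^T *m (Qi *m u)) (K^T *m (Qi *m u)) = dotv u u.
Proof.
rewrite -dotv_gram dotv_trmx (proj1 Qi_props).
by rewrite (mulmxA Qi _ (Qi *m u)) (mulmxA _ Qi u) QiQQi mul1mx.
Qed.

Let dotvB u : dotv u (B *m u) = dotv (M^T *m (Qi *m u)) (M^T *m (Qi *m u)).
Proof. by rewrite -dotv_gram dotv_trmx (proj1 Qi_props) /B !mulmxA. Qed.

(** The bound closes on itself: for [b = Qi M q] and [h = Qi b], [b.b = q.M^T h], while the
    embedding gives [3/4 |M^T h|^2 <= b.b]. Expanding [|M^T h - 4/3 q|^2 >= 0] combines the two
    without square roots. *)
Lemma preconditioned_rhs_le q :
  dotv (Qi *m (M *m q)) (Qi *m (M *m q)) <= 4 / 3 * dotv q q.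
Proof.
set b := Qi *m _; pose h := Qi *m b.
have bb : dotv b b = dotv q (M^T *m h).
  by rewrite {1}/b dotv_trmx (proj1 Qi_props) dotv_trmx.
have := embed_lb h; rewrite QiK_isometry bb.
have := dotv_ge0 (M^T *m h - (4 / 3) *: q).
rewrite !dotv_lin (dotvC (M^T *m h) q).
by move: (dotv q _) (dotv q q) (dotv (M^T *m h) _) => *; lra.
Qed.

Lemma pcg_correction_le (c : 'I_n -> R) q t :
  (forall i, 0 <= c i) -> (forall i, dotv (row i W)^T (row i W)^T = 1) ->
  norm2 (dg (\col_i Num.sqrt (c i)) *m W *m pinvMP K *m
    (M *m M^T *m (Qi *m cg_iterate B (Qi *m (M *m q)) t) - M *m q)) ^+ 2 <=
  (\sum_i c i) * (5 / 3 * (2 / 5) ^+ t * (4 / 3 * dotv q q)).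
Proof.
move=> c_ge0 W1; set b := Qi *m (M *m q); set z := cg_iterate B b t.
set v := (X in norm2 X).
(* The pseudoinverse is [K^T Qi Qi]; its last [Qi] turns the unpreconditioned residual into
   [B z - b]. *)
have -> : v = dg (\col_i Num.sqrt (c i)) *m W *m (K^T *m (Qi *m (B *m z - b))).
  rewrite /v pinvMP_row_full // -(proj2 Qi_props) -!(mulmxA _ _ (_ - _)).
  by rewrite mulmxBr (mulmxA Qi (M *m M^T)) (mulmxA _ Qi z) -!mulmxA.
apply: le_trans (diag_weight_mulmx_le _ _ _ c_ge0 W1) _.
rewrite ler_wpM2l ?sumr_ge0 // QiK_isometry -opprB dotvNl dotvNr opprK.
have B_sym : B^T = B by rewrite /B !trmx_mul trmxK (proj1 Qi_props) !mulmxA.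
(* The embedding at [Qi u] compares [|K^T Qi u|^2 = u.u] with [|M^T Qi u|^2 = u.Bu], which inverts
   the constants [5/4] and [3/4]. *)
have B_lb u : 4 / 5 * dotv u u <= dotv u (B *m u).
  by rewrite dotvB -(QiK_isometry u); have := embed_ub (Qi *m u); lra.
have B_ub u : dotv u (B *m u) <= 4 / 3 * dotv u u.
  by rewrite dotvB -(QiK_isometry u); have := embed_lb (Qi *m u); lra.
have l_gt0 : 0 < 4 / 5 :> R by lra.
have le_lL : 4 / 5 <= 4 / 3 :> R by lra.
apply: le_trans (cg_residual_le _ b _ _ B_sym l_gt0 le_lL B_lb B_ub t) _.
have -> : 1 - 4 / 5 / (4 / 3) = 2 / 5 :> R by field.
have -> : 4 / 3 / (4 / 5) = 5 / 3 :> R by field.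
by rewrite ler_wpM2l ?preconditioned_rhs_le //.
Qed.

End PreconditionedCG.

(** * The right-hand side near the central path *)

Section InteriorPointBounds.
Context {R : realType} {m n : nat} (A : 'M[R]_(m, n)) (x s : 'cV[R]_n).
Hypothesis xs_gt0 : forall i, 0 < x i 0 /\ 0 < s i 0.

Lemma dg_mulmxE {k l} (c : 'cV[R]_k) (M : 'M[R]_(k, l)) i j :
  (dg c *m M) i j = c i 0 * M i j.
Proof. by rewrite mul_diag_mx !mxE. Qed.

Lemma tr_dg {k} (c : 'cV[R]_k) : (dg c)^T = dg c.
Proof. exact: tr_diag_mx. Qed.

Lemma invmx_dg_ones : invmx (dg s) *m ones R n = \col_i (s i 0)^-1.
Proof.
have s_neq0 i : s i 0 != 0 by rewrite gt_eqF // (xs_gt0 i).2.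
have s_unit : dg s \in unitmx.
  apply: (mulmx1_unit (B := dg (\col_i (s i 0)^-1)) _).1.
  apply/matrixP => i j; rewrite dg_mulmxE !mxE.
  by rewrite mulrnAr mulfV.
apply: (can_inj (mulKmx s_unit)); rewrite mulKVmx //.
by apply/matrixP => i j; rewrite dg_mulmxE !mxE mulfV.
Qed.

(** Factoring out [A D] puts [p] in the form [M q] required by [pcg_correction_le]. *)
Lemma rhsE sigma : rhs sigma A x s = A *m Dmx x s *m
  \col_i (Num.sqrt (x i 0 * s i 0) - sigma * mu x s / Num.sqrt (x i 0 * s i 0)).
Proof.
rewrite /rhs -mulmxA invmx_dg_ones scalemxAr -mulmxN -mulmxDr -mulmxA.
congr (_ *m _); apply/matrixP => i j; rewrite dg_mulmxE !mxE (ord1 j).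
have [x_gt0 s_gt0] := xs_gt0 i.
have sx_neq0 : Num.sqrt (x i 0) != 0 by rewrite gt_eqF ?sqrtr_gt0.
have ss_neq0 : Num.sqrt (s i 0) != 0 by rewrite gt_eqF ?sqrtr_gt0.
rewrite sqrtrM ?ltW // -[X in _ + X = _](sqr_sqrtr (ltW x_gt0)).
rewrite -[X in X^-1](sqr_sqrtr (ltW s_gt0)).
by field; rewrite sx_neq0 ss_neq0.
Qed.

Lemma sum_xs : (0 < n)%N -> \sum_i x i 0 * s i 0 = n%:R * mu x s.
Proof.
by move=> n_gt0; rewrite /mu mulVKf ?dotvE // pnatr_eq0 -lt0n.
Qed.

(** Centrality keeps each [x_i s_i] above [(1 - theta) mu]. In the expanded square of an entry,
    [x_i s_i] sums to [n mu], the cross term is nonpositive, and the last term is at most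
    [mu / (1 - theta)]. *)
Lemma rhs_sqr_le (theta sigma : R) (y : 'cV[R]_m) :
  N2 theta x y s -> 0 < theta < 1 -> 0 <= sigma <= 1 -> (0 < n)%N ->
  norm2 (\col_i (Num.sqrt (x i 0 * s i 0) -
    sigma * mu x s / Num.sqrt (x i 0 * s i 0))) ^+ 2 <=
  (1 + (1 - theta)^-1) * (n%:R * mu x s).
Proof.
move=> [xs_near _] /andP[theta_gt0 theta_lt1] /andP[sigma_ge0 sigma_le1] n_gt0.
have mu_ge0 : 0 <= mu x s.
  by rewrite -(pmulr_rge0 _ theta_gt0) (le_trans (norm2_ge0 _) xs_near).
have thetamu_ge0 : 0 <= theta * mu x s by rewrite mulr_ge0 // ltW.
have xs_ge i : (1 - theta) * mu x s <= x i 0 * s i 0.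
  have : (x i 0 * s i 0 - mu x s) ^+ 2 <= (theta * mu x s) ^+ 2.
    have := xs_near; rewrite -(ler_pXn2r (n := 2)) ?nnegrE ?norm2_ge0 //.
    apply: le_trans; rewrite norm2_sqr dotvE (bigD1 i) //= !mxE mulr1 -expr2.
    by rewrite lerDl sumr_ge0 // => j _; rewrite -expr2 sqr_ge0.
  move: (x i 0 * s i 0) => z.
  rewrite -[leLHS]real_normK ?num_real // ler_pXn2r ?nnegrE //.
  by rewrite ler_norml => /andP[+ _]; lra.
have -> : (1 + (1 - theta)^-1) * (n%:R * mu x s) =
    \sum_i x i 0 * s i 0 + \sum_(i < n) (1 - theta)^-1 * mu x s.
  rewrite sum_xs // sumr_const card_ord -mulr_natl.
  by move: (mu x s) => M; ring.
rewrite -big_split /= norm2_sqr dotvE; apply: ler_sum => i _; rewrite mxE.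
have [x_gt0 s_gt0] := xs_gt0 i.
have xs_pos : 0 < x i 0 * s i 0 by rewrite mulr_gt0.
have r_gt0 : 0 < Num.sqrt (x i 0 * s i 0) by rewrite sqrtr_gt0.
have := sqr_sqrtr (ltW xs_pos); have := xs_ge i.
move: (_ * s i 0) (Num.sqrt _) (mu x s) r_gt0 mu_ge0.
move=> c a M a_gt0 M_ge0 h a2; rewrite -{c}a2 in h *.
have -> : (a - sigma * M / a) * (a - sigma * M / a) =
   a ^+ 2 - 2 * sigma * M + sigma ^+ 2 * (M * (M / a ^+ 2)).
  by field; rewrite gt_eqF.
have Ma : M / a ^+ 2 <= (1 - theta)^-1.
  by rewrite ler_pdivrMr ?exprn_gt0 // mulrC ler_pdivlMr ?subr_gt0 // mulrC.
have t_le : sigma ^+ 2 * (M * (M / a ^+ 2)) <= (1 - theta)^-1 * M.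
  rewrite -[leRHS]mul1r.
  rewrite ler_pM ?sqr_ge0 ?exprn_ile1 ?mulr_ge0 ?invr_ge0 ?sqr_ge0 //.
  by rewrite mulrC ler_wpM2r.
have : 0 <= sigma * M by rewrite mulr_ge0.
by lra.
Qed.

End InteriorPointBounds.

(** * The iteration bound on the embedding event *)

Theorem lemma23 (R : realType) (theta zeta : R)
    (htheta : 0 < theta < 1) (hzeta : 0 < zeta < 2^-1) :
  exists2 C : R, 0 < C &
  forall (m n : nat) (A : 'M[R]_(m, n)) (hA : row_free A) (hmn : (m <= n)%N)
    (x : 'cV[R]_n) (y : 'cV[R]_m) (s : 'cV[R]_n) (hxys : N2 theta x y s)
    (sigma : R) (hsigma : 0 <= sigma <= 1)
    (eta : R) (heta : 0 < eta < 1)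
    (delta : R) (hdelta : 0 < delta)
    (hratio : 2 <= n%:R * mu x s / delta)
    (U : 'M[R]_m) (sg : 'cV[R]_m) (V : 'M[R]_(n, m))
    (hsvd : thin_svd (A *m Dmx x s) U sg V)
    (w r : nat) (hr : (0 < r <= w)%N)
    (cw cr : R)
    (hwO : w%:R <= cw * (m%:R / zeta ^+ 2 * ln (m%:R / eta)))
    (hrO : r%:R <= cr * (zeta^-1 * ln (m%:R / eta)))
    (hsketch : 1 - eta <= unif_pr R (fun om : sketch_sample n w r =>
       let W := sketch_mx R om in
       opnorm2 (V^T *m W *m W^T *m V - 1%:M) <= zeta / 2)),
  let p := rhs sigma A x s in
  1 - eta <= unif_pr R (fun om : sketch_sample n w r =>
    let W := sketch_mx R om in
    Qmx A x s W \in unitmx /\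
    forall t : nat, C * ln (n%:R * mu x s / delta) <= t%:R ->
      norm2 (correction A x s W p (sketch_pcg A x s W p t)) <= delta).
Proof.
have c_gt0 : 0 < 1 + (1 - theta)^-1.
  by rewrite addr_gt0 // invr_gt0 subr_gt0; case/andP: htheta.
(* [20/9] is [5/3 * 4/3] from [pcg_correction_le]; the other factor is that of [rhs_sqr_le]. *)
have [||C C_gt0 C_count] := @ln_iteration_count R (2 / 5)
  (20 / 9 * (1 + (1 - theta)^-1)); [lra | by rewrite mulr_gt0 |].
exists C => // m n A hA _ x y s hxys sigma hsigma eta _ delta hdelta hratio.
(* In [lazy zeta], [zeta] is the reduction of [let], not the sketching accuracy. *)
move=> U sg V hsvd w r /andP[r_gt0 _] _ _ _ _ hsketch; lazy zeta.
(* The rest is deterministic on the event of [hsketch], which serves all [t] at once. *)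
apply: le_trans hsketch _; apply: unif_pr_le => om.
set W := sketch_mx R om => W_sketch.
have xs_gt0 := hxys.2.
have n_gt0 : (0 < n)%N.
  case: posnP => // n0; have : n%:R = 0 :> R by rewrite n0.
  by move: hratio => /[swap] ->; rewrite !mul0r; lra.
pose M := A *m Dmx x s.
have M_inj (u : 'cV[R]_m) : M^T *m u = 0 -> u = 0.
  rewrite trmx_mul tr_dg -mulmxA => Mu; apply: (row_free_trmx_inj _ _ hA).
  apply/matrixP => i j; have /matrixP/(_ i j) := Mu.
  rewrite dg_mulmxE !mxE => /eqP; rewrite mulf_eq0 gt_eqF => [/eqP//|].
  by rewrite divr_gt0 ?sqrtr_gt0; case: (xs_gt0 i).
have embed u : 3 / 4 * dotv (M^T *m u) (M^T *m u) <=
    dotv ((M *m W)^T *m u) ((M *m W)^T *m u) <=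
    5 / 4 * dotv (M^T *m u) (M^T *m u).
  (* [zeta < 1/2] gives distortion [zeta / 2 < 1/4], whence [3/4] and [5/4]. *)
  have zeta4 : zeta / 2 * dotv (M^T *m u) (M^T *m u) <=
      1 / 4 * dotv (M^T *m u) (M^T *m u).
    by rewrite ler_wpM2r ?dotv_ge0 //; lra.
  have := sketch_embedding _ _ _ _ _ _ u hsvd W_sketch.
  rewrite -/M => /le_trans/(_ zeta4); rewrite ler_norml; lra.
have embed_lb u := proj1 (andP (embed u)).
have embed_ub u := proj2 (andP (embed u)).
have QE : Qmx A x s W = M *m W *m (M *m W)^T.
  by rewrite !trmx_mul tr_dg !mulmxA.
have NE : normal_mx A x s = M *m M^T.
  by rewrite /normal_mx trmx_mul tr_dg !mulmxA.
(* Invertibility of [Q] gives [Q^{-1/2}] in the algorithm its intended meaning. *)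
split; first by rewrite QE sketched_gram_unitmx.
move=> t t_ge.
rewrite -(ler_pXn2r (n := 2)) ?nnegrE ?norm2_ge0 ?(ltW hdelta) //.
rewrite /correction /sketch_pcg rhsE // QE NE.
have xs_ge0 i : 0 <= x i 0 * s i 0 by rewrite ltW // mulr_gt0; case: (xs_gt0 i).
apply: le_trans (pcg_correction_le M W M_inj embed_lb embed_ub _ _ t xs_ge0
  (fun i => sketch_row_unit om i r_gt0)) _.
rewrite (sum_xs _ _ n_gt0).
have := C_count _ t hratio t_ge.
have := rhs_sqr_le _ _ xs_gt0 _ _ _ hxys htheta hsigma n_gt0; rewrite norm2_sqr.
move: (\col__ _) => q qq_le.
move: (n%:R * mu x s) hratio qq_le => a; rewrite ler_pdivlMr // => a_ge qq_le.
(* [C_count] was applied to [a / delta]; clearing [delta^2] gives the squared claim. *)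
rewrite [leLHS](_ : _ =
  20 / 9 * (1 + (1 - theta)^-1) * (2 / 5) ^+ t * a ^+ 2 / delta ^+ 2);
  last first.
  by rewrite -[RHS]mulrA -(expr_div_n a).
rewrite ler_pdivrMr ?exprn_gt0 // mul1r.
apply: le_trans.
have a_ge0 : 0 <= a by apply: le_trans a_ge; rewrite mulr_ge0 // ltW.
rewrite [leRHS](_ : _ = a * (5 / 3 * (2 / 5) ^+ t *
  (4 / 3 * ((1 + (1 - theta)^-1) * a)))); last first.
  by move: ((1 - theta)^-1) ((2 / 5) ^+ t) => *; field.
by rewrite !ler_wpM2l ?mulr_ge0 ?exprn_ge0.
Qed.
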